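(* Let $\nu$ be a (Borel) probability measure on $[0,1]$, and let $(G_n)_{n\ge1}$ be the sequence of random graphs constructed from an i.i.d. sequence $(\theta_j)_{j\ge1}$ with distribution $\nu$ (as defined in the context). Let $\Gamma_\nu$ be the graph limit defined by the kernel $W:([0,1]^2)^2\to[0,1]$, $$W\bigl((s_1,t_1),(s_2,t_2)\bigr)=\begin{cases}s_2,& t_1<t_2,\\ s_1,& t_1>t_2,\\ 0,& t_1=t_2,\end{cases}$$ on the probability space $([0,1]^2,\mu_\nu)$, where $\mu_\nu=\nu\times\lambda$ and $\lambda$ is Lebesgue measure on $[0,1]$. Then $G_n\to\Gamma_\nu$ in probability as $n\to\infty$.
   Context: All graphs are simple and undirected, and finite unless said otherwise. The random graphs $G_n$: let $\theta_1,\theta_2,\dots$ be an i.i.d. sequence of random variables with distribution $\nu$. Conditionally given this sequence, let $G_\infty$ be the infinite random graph with vertex set $\{1,2,3,\dots\}$ in which, for each pair $i\ne j$, the edge $\{i,j\}$ appears with probability $\theta_{\max\{i,j\}}$, all edges appearing independently (conditionally on $(\theta_j)_{j\ge1}$). Then $G_n$ is the subgraph of $G_\infty$ induced on $\{1,\dots,n\}$. Graph limits: for finite graphs $F,G$, let $t(F,G)$ be the probability that a uniformly random map $\varphi:V(F)\to V(G)$ is a graph homomorphism, i.e. $\varphi(i)$ and $\varphi(j)$ are adjacent in $G$ whenever $i$ and $j$ are adjacent in $F$. A kernel on a probability space $(S,\mu)$ is a symmetric measurable function $W:S^2\to[0,1]$. It defines a graph limit $\Gamma_W$, which is determined by the numbers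 $$t(F,\Gamma_W)=\int_{S^{V(F)}}\prod_{\{i,j\}\in E(F)}W(x_i,x_j)\prod_{i\in V(F)}d\mu(x_i)$$ for all finite graphs $F$. The set of all (unlabelled) graphs together with all graph limits is a compact metric space, in which a sequence of graphs $H_n$ with $|V(H_n)|\to\infty$ converges to a graph limit $\Gamma$ if and only if $t(F,H_n)\to t(F,\Gamma)$ for every finite graph $F$. For random graphs $G_n$ with $|V(G_n)|=n$, ''$G_n\to\Gamma$ in probability'' means convergence in probability in this metric space; equivalently, for every finite graph $F$, $t(F,G_n)\to t(F,\Gamma)$ in probability. *)

(* Defs.v *)
From HB Require Import structures.
From mathcomp Require Import all_boot all_order all_algebra.
From mathcomp Require Import all_classical all_reals all_analysis.
From mathcomp Require Import lra.

Set Implicit Arguments.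
Unset Strict Implicit.
Unset Printing Implicit Defensive.

Import Order.TTheory GRing.Theory Num.Def Num.Theory.
Import numFieldNormedType.Exports.

Local Open Scope classical_set_scope.
Local Open Scope ring_scope.

(* The vertex type V may be infinite (V = nat is used for G_oo). *)
Record sgraph (V : Type) := SGraph {
  adj :> rel V;
  adj_sym : symmetric adj;
  adj_irr : irreflexive adj }.

Section induced_subgraph.
Variables (n : nat) (G : sgraph nat).
Let a : rel 'I_n := fun i j => adj G i j.

Let a_sym : symmetric a. Proof. by move=> i j; exact: adj_sym. Qed.
Let a_irr : irreflexive a. Proof. by move=> i; exact: adj_irr. Qed.

(* the subgraph of G induced on the first n vertices 0, ..., n - 1 *)
Definition induced_prefix : sgraph 'I_n := SGraph a_sym a_irr.
End induced_subgraph.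

(* Every finite graph is isomorphic to one with vertex type 'I_k. *)
Definition fgraph := {k : nat & sgraph 'I_k}.

Section product_power.
Context d (S : measurableType d) (R : realType).

Definition consT k (x : S * k.-tuple S) : k.+1.-tuple S :=
  [the k.+1.-tuple S of x.1 :: x.2].

Lemma measurable_consT k : measurable_fun setT (@consT k).
Proof. by apply: measurable_cons. Qed.

HB.instance Definition _ k := isMeasurableFun.Build _ _ _ _ (@consT k)
  (@measurable_consT k).

Local Open Scope ereal_scope.

(* the k-fold product measure mu x ... x mu on S ^ k *)
Fixpoint prob_power (mu : probability S R) k : probability (k.-tuple S) R :=
  if k is k'.+1 then distribution (mu \x prob_power mu k') (@consT k')
  else \d_([tuple] : 0.-tuple S).
End product_power.

Section homomorphism_densities.
Context (R : realType).

Definition is_hom (k : nat) (F : sgraph 'I_k) (V : Type) (G : sgraph V)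
    (phi : 'I_k -> V) : bool :=
  [forall i, forall j, adj F i j ==> adj G (phi i) (phi j)].

(* t(F, G) *)
Definition hom_density (F : fgraph) (V : finType) (G : sgraph V) : R :=
  #|[set phi : {ffun 'I_(tag F) -> V} | is_hom (tagged F) G phi]|%:R /
  #|{ffun 'I_(tag F) -> V}|%:R.

(* t(F, Gamma_W) for W a kernel on the probability space (S, mu) *)
Definition kernel_density d (S : measurableType d) (mu : probability S R)
    (W : S -> S -> R) (F : fgraph) : R :=
  \int[prob_power mu (tag F)]_x
    \prod_(e : 'I_(tag F) * 'I_(tag F) |
           (e.1 < e.2)%N && adj (tagged F) e.1 e.2)
      W (tnth x e.1) (tnth x e.2).

(* The space of unlabelled finite graphs and graph limits, in the
   Diaconis-Janson coordinates: a graph G is the point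
   ((t(F, G))_F, 1 / |V(G)|) and a limit Gamma is ((t(F, Gamma))_F, 0).
   The last coordinate separates graphs of different orders having the same
   homomorphism densities, and separates graphs from limits. *)
Record glim := Glim { dens : fgraph -> R ; inv_order : R }.

Definition glim_of_graph (V : finType) (G : sgraph V) : glim :=
  Glim (fun F => hom_density F G) #|V|%:R^-1.

Definition glim_of_kernel d (S : measurableType d) (mu : probability S R)
    (W : S -> S -> R) : glim :=
  Glim (kernel_density mu W) 0.

(* A metric for the product topology of the coordinates: the weights tend to 0
   and only finitely many F have a given order. *)
Definition glim_dist (x y : glim) : R :=
  Num.max `|inv_order x - inv_order y|
    (sup [set 2^-1 ^+ tag F * `|dens x F - dens y F| | F in [set: fgraph]]).

Definition cvg_in_probability d (T : measurableType d) (P : probability T R)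
    (X : nat -> T -> glim) (x : glim) : Prop :=
  forall eps : R, 0 < eps ->
    (fun n => P [set w | eps < glim_dist (X n w) x]) @ \oo --> 0%E.

End homomorphism_densities.

Section glim_dist_cvg.
Context (R : realType).

(* all graphs and graph limits have coordinates in [0, 1] *)
Definition bounded_glim (x : glim R) := forall F, 0 <= dens x F <= 1.

Let dens_dist_le1 (x y : glim R) F : bounded_glim x -> bounded_glim y ->
  `|dens x F - dens y F| <= 1.
Proof.
by move=> /(_ F) bx /(_ F) b_y; rewrite ler_norml; apply/andP; split; lra.
Qed.

Let dens_le_glim_dist (x y : glim R) F : bounded_glim x -> bounded_glim y ->
  2^-1 ^+ tag F * `|dens x F - dens y F| <= glim_dist x y.
Proof.
move=> bx b_y; rewrite /glim_dist le_max; apply/orP; right.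
apply: ub_le_sup; last by exists F.
exists 1 => _ [G _ <-]; rewrite -[leRHS]mulr1; apply: ler_pM => //.
- by rewrite exprn_ile1// invf_le1// ler1n.
- exact: dens_dist_le1.
Qed.

Let code k (F : sgraph 'I_k) : {ffun 'I_k * 'I_k -> bool} :=
  [ffun e => adj F e.1 e.2].

Let code_inj k : injective (@code k).
Proof.
move=> [a aS aI] [b bS bI] /ffunP ab.
have {}ab : a = b.
  by apply/funext => i; apply/funext => j; have := ab (i, j); rewrite !ffunE.
by case: _ / ab bS bI => bS bI; congr SGraph; exact: Prop_irrelevance.
Qed.

(* glim_dist metrizes the coordinatewise convergence. *)
Lemma glim_dist_cvgP (x : nat -> glim R) (y : glim R) :
  (forall m, bounded_glim (x m)) -> bounded_glim y ->
  (fun m => glim_dist (x m) y) @ \oo --> 0 <->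
  (fun m => inv_order (x m)) @ \oo --> inv_order y /\
  forall F, (fun m => dens (x m) F) @ \oo --> dens y F.
Proof.
move=> bx b_y; have dge0 m : 0 <= glim_dist (x m) y.
  by rewrite /glim_dist le_max normr_ge0.
split=> [/cvgr0Pnorm_lt xy|[xyo xyd]].
  split=> [|F]; apply/cvgrPdist_lt => e e0.
    near=> m; rewrite distrC.
    have : `|glim_dist (x m) y| < e by near: m; exact: xy.
    rewrite ger0_norm//; apply: le_lt_trans.
    by rewrite /glim_dist le_max lexx.
  have k0 : 0 < 2^-1 ^+ tag F :> R by rewrite exprn_gt0// invr_gt0.
  near=> m; rewrite distrC -(ltr_pM2l k0).
  have : `|glim_dist (x m) y| < 2^-1 ^+ tag F * e.
    by near: m; apply: xy; exact: mulr_gt0.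
  by rewrite ger0_norm//; apply: le_lt_trans; exact: dens_le_glim_dist.
apply/cvgr0Pnorm_le => e e0.
have [N _ Ne] : \forall k \near \oo, 2^-1 ^+ k < e :> R.
  have : (fun k => 2^-1 ^+ k : R) @ \oo --> 0.
    by apply: cvg_expr; rewrite ger0_norm ?invr_ge0// invf_lt1// ltr1n.
  by move=> /cvgr0Pnorm_lt/(_ _ e0); apply: filterS => k;
    rewrite ger0_norm// exprn_ge0// invr_ge0.
have small : \forall m \near \oo, forall (k : 'I_N) (F : sgraph 'I_k),
    `|dens (x m) (existT _ (k : nat) F) - dens y (existT _ (k : nat) F)| < e.
  apply: filter_forall => k.
  have : \forall m \near \oo, forall f (F : sgraph 'I_k), code F = f ->
      `|dens (x m) (existT _ (k : nat) F) - dens y (existT _ (k : nat) F)| < e.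
    apply: filter_forall => f.
    have [[F Ff]|nF] := pselect (exists F : sgraph 'I_k, code F = f).
      near=> m => F'; rewrite -Ff => /code_inj ->; rewrite distrC.
      by near: m; have /cvgrPdist_lt := xyd (existT _ (k : nat) F); exact.
    by near=> m => F Ff; case: nF; exists F.
  by apply: filterS => m H F; exact: (H _ F erefl).
near=> m; rewrite ger0_norm// /glim_dist ge_max; apply/andP; split.
  by rewrite distrC ltW//; near: m; have /cvgrPdist_lt := xyo; exact.
have p1 k : 2^-1 ^+ k <= 1 :> R.
  by rewrite exprn_ile1// ?invr_ge0// invf_le1// ler1n.
have p0 k : 0 <= 2^-1 ^+ k :> R by rewrite exprn_ge0// invr_ge0.
apply: ge_sup; first by eexists; exists (existT _ 0%N (induced_prefix 0 (SGraph
  (fun _ _ => erefl : false = false) (fun=> erefl : false = false)))).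
move=> _ [[k F] _ <-] /=; have [kN|Nk] := ltnP k N.
  apply: le_trans (ler_piMl (normr_ge0 _) (p1 k)) _.
  have H : forall (k : 'I_N) (F : sgraph 'I_k),
    `|dens (x m) (existT _ (k : nat) F) - dens y (existT _ (k : nat) F)| < e.
    by near: m.
  exact/ltW/(H (Ordinal kN) F).
apply: le_trans (ler_piMr (p0 k) (dens_dist_le1 _ (bx m) b_y)) _.
exact/ltW/Ne.
Unshelve. all: by end_near.
Qed.

End glim_dist_cvg.

Section conditional_independence.
Context d (T : measurableType d) (R : realType) (P : probability T R).

(* f is a version of the conditional probability P(E | G), for G a
   sub-sigma-algebra of the sample space *)
Definition is_cond_prob (G : set (set T)) (E : set T) (f : T -> R) : Prop :=
  (forall B : set R, measurable B -> G (f @^-1` B)) /\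
  (forall A, G A -> P (A `&` E) = \int[P]_(w in A) (f w)%:E)%E.

(* The events (E i), i in D, are conditionally independent given G: for every
   finite subfamily, the product of the conditional probabilities is a
   conditional probability of the intersection. *)
Definition cond_independent (G : set (set T)) (I : eqType) (D : pred I)
    (E : I -> set T) : Prop :=
  forall f : I -> T -> R, (forall i, D i -> is_cond_prob G (E i) (f i)) ->
  forall s : seq I, uniq s -> all D s ->
    is_cond_prob G (\bigcap_(i in [set` s]) E i)
      (fun w => \prod_(i <- s) f i w).

Definition generated_sigma (X : nat -> T -> R) : set (set T) :=
  <<s [set A | exists i (B : set R), measurable B /\ A = X i @^-1` B] >>.

Definition mutually_independent (X : nat -> T -> R) : Prop :=
  forall (s : seq nat) (B : nat -> set R), uniq s ->
    (forall i, measurable (B i)) ->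
    P (\bigcap_(i in [set` s]) X i @^-1` B i) =
    (\prod_(i <- s) P (X i @^-1` B i))%E.

Definition iid (nu : probability R R) (X : nat -> {RV P >-> R}) : Prop :=
  (forall i B, measurable B -> distribution P (X i) B = nu B) /\
  mutually_independent (fun i => X i : T -> R).

(* The random graph G_oo built from theta. Vertex i : nat stands for the vertex
   i + 1 of the informal description, and theta i for theta_(i + 1). *)
Definition infinite_random_graph (theta : nat -> {RV P >-> R})
    (G : T -> sgraph nat) : Prop :=
  let sigma := generated_sigma (fun i => theta i : T -> R) in
  let edge (e : nat * nat) := [set w | adj (G w) e.1 e.2] in
  [/\ forall e, measurable (edge e),
      forall e, e.1 != e.2 ->
        is_cond_prob sigma (edge e) (theta (maxn e.1 e.2))
    & cond_independent sigma [pred e | e.1 < e.2]%N edge].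

End conditional_independence.

Section limit_kernel.
Context (R : realType).

(* Lebesgue measure on [0, 1], as a probability measure on R. The library's
   lebesgue_measure lives on measurableTypeR R, a copy of R with the same
   (Borel) measurable sets. *)
Definition lebesgue01 (A : set R) : \bar R :=
  mrestr (@lebesgue_measure R) (measurable_itv `[0 : R, 1]) A.

Let lebesgue01_0 : lebesgue01 set0 = 0%E.
Proof. exact: measure0. Qed.

Let lebesgue01_ge0 A : (0 <= lebesgue01 A)%E.
Proof. exact: measure_ge0. Qed.

Let lebesgue01_sigma_additive : semi_sigma_additive lebesgue01.
Proof.
exact: (@measure_semi_sigma_additive _ (measurableTypeR R) R
  (mrestr (@lebesgue_measure R) (measurable_itv `[0 : R, 1]))).
Qed.

HB.instance Definition _ := isMeasure.Build _ _ _ lebesgue01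
  lebesgue01_0 lebesgue01_ge0 lebesgue01_sigma_additive.

Let lebesgue01T : lebesgue01 setT = 1%E.
Proof.
by rewrite /lebesgue01 /mrestr setTI lebesgue_measure_itv/= lte_fin ltr01 sube0.
Qed.

HB.instance Definition _ :=
  Measure_isProbability.Build _ _ _ lebesgue01 lebesgue01T.

(* nu x lambda, a probability measure on R * R carried by [0, 1] ^ 2 when nu is
   carried by [0, 1] *)
Definition mu_nu (nu : probability R R) : probability (R * R)%type R :=
  (nu \x lebesgue01)%E.

Definition Wker (x y : R * R) : R :=
  if x.2 < y.2 then y.1 else if y.2 < x.2 then x.1 else 0.

Definition Gamma_nu (nu : probability R R) : glim R :=
  glim_of_kernel (mu_nu nu) Wker.

End limit_kernel.

(* Main.v *)
From HB Require Import structures.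
Require Import Defs.
From mathcomp Require Import all_boot all_order all_algebra.
From mathcomp Require Import all_classical all_reals all_analysis.
From mathcomp Require Import measurable_realfun lra zify.

(** Fix a finite graph F with k vertices. The density t(F, G_n) is the average,
    over the n^k maps phi from the vertices of F to those of G_n, of the
    indicator that phi is a homomorphism.

    The mean. If phi is injective, conditional independence of the edges turns
    the probability that phi is a homomorphism into the expectation of the
    product, over the edges ij of F, of theta at max (phi i) (phi j). The theta
    at the vertices of phi are k independent samples of nu, so this is an
    integral over nu^k ([mean_hom]): that of the product of the kernel values
    at the points (s_i, phi i), because the kernel uses its second coordinates
    only to decide which one is larger. Cut [0, 1[ into n intervals of length
    1/n and round each t_i to the index of the interval it lies in. The
    k-tuple of rounded t's is uniform on the maps phi and independent of the
    s's, so the average of [mean_hom] over all phi is the integral over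
    (nu x lambda)^k of the kernel product with rounded t's. For given points,
    rounding preserves the order of the t's as soon as n is large, so dominated
    convergence yields the limit t(F, Gamma_nu) ([cvg_mean_density]).

    The fluctuations. If two maps phi and psi are injective with disjoint
    images, the events that they are homomorphisms involve disjoint sets of
    edges and of theta's, and are independent ([probability_is_hom2]). So in
    the second moment of t(F, G_n) minus the average of [mean_hom], only pairs
    (phi, psi) that fail to be jointly injective contribute. There are
    O(n^(2k-1)) of them among n^(2k), which also covers the non-injective maps,
    for which [mean_hom] is not the probability of a homomorphism. Hence the
    second moment is O(1/n), and Markov's inequality gives convergence in
    probability of each density ([cvg_hom_density_prob]).

    The metric. A graph F of order k enters the distance with weight 2^-k, so
    an excess over eps is due to one of finitely many F, and a union bound
    concludes. *)

Set Implicit Arguments.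
Unset Strict Implicit.
Unset Printing Implicit Defensive.

Import Order.TTheory GRing.Theory Num.Theory.
Import numFieldNormedType.Exports.

Local Open Scope classical_set_scope.
Local Open Scope ring_scope.

(** * Laws of tuples *)

Lemma measurable_mktuple d d' (T : measurableType d) (S : measurableType d') k
    (X : 'I_k -> T -> S) :
  (forall i, measurable_fun setT (X i)) ->
  measurable_fun setT (fun w => [tuple X i w | i < k]).
Proof.
move=> mX; apply/measurable_fun_tnthP => i.
by apply: (eq_measurable_fun (X i)) => // w _; rewrite /= tnth_mktuple.
Qed.

Section power_law.
Context d (S : measurableType d) (R : realType) (nu : probability S R).

Definition box k (B : 'I_k -> set S) : set (k.-tuple S) :=
  [set x | forall i, B i (tnth x i)].

Lemma measurable_box k (B : 'I_k -> set S) :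
  (forall i, measurable (B i)) -> measurable (box B).
Proof.
move=> mB; rewrite (_ : box B = \bigcap_(i in setT)
    ((fun x : k.-tuple S => tnth x i) @^-1` B i)).
  apply: fin_bigcap_measurable => [|i _]; first exact: finite_finset.
  by rewrite -[X in measurable X]setTI; exact: measurable_tnth.
by apply/seteqP; split => x xB i => [_|]; exact: xB.
Qed.

Lemma prob_power_box k (B : 'I_k -> set S) :
  (forall i, measurable (B i)) ->
  (prob_power nu k (box B) = \prod_i nu (B i))%E.
Proof.
elim: k B => [B _|k IH B mB] /=.
  by rewrite diracE big_ord0 mem_set// => -[].
rewrite big_ord_recl -IH//= -product_measure1E//; last first.
  exact: measurable_box.
rewrite /distribution /pushforward; congr ((_ \x _)%E _).
apply/seteqP; split => [[x y] xyB|[x y] [/= Bx By] i].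
  by split=> [|i]; [have := xyB ord0|have := xyB (lift ord0 i); rewrite tnthS].
by case: (unliftP ord0 i) => [j|] ->; rewrite ?tnthS //; exact: By.
Qed.

Lemma measurable_boxes k : @measurable _ (k.-tuple S) =
  <<s [set C | exists2 B : 'I_k -> set S,
    forall i, measurable (B i) & C = box B] >>.
Proof.
apply/seteqP; split.
  apply: smallest_sub; first exact: smallest_sigma_algebra.
  rewrite -bigcup_seq => C [i _ [A mA <-]].
  apply: sub_sigma_algebra => /=.
  exists (fun j => if j == i then A else setT) => [j|]; first by case: ifP.
  apply/seteqP; split=> x /= => [[_ Ax] j|/(_ i)]; last by rewrite eqxx.
  by case: eqP => // ->.
apply: smallest_sub; first exact: sigma_algebra_measurable.
by move=> _ [B mB ->]; exact: measurable_box.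
Qed.

(** Boxes generate the product sigma-algebra and are stable under intersection,
    so a law is determined by its values on them. The event [D] lets the same
    lemma express independence: the hypothesis says that the tuple is
    independent of [D] as far as boxes can tell, and the conclusion that it is
    independent of [D] outright. *)
Lemma law_tuple d' (T : measurableType d') (P : probability T R) (D : set T)
    k (X : 'I_k -> T -> S) :
  measurable D -> (forall i, measurable_fun setT (X i)) ->
  (forall B : 'I_k -> set S, (forall i, measurable (B i)) ->
    (P (\bigcap_i X i @^-1` B i `&` D) = P D * \prod_i nu (B i))%E) ->
  forall C, measurable C ->
    (P ([set w | C [tuple X i w | i < k]] `&` D) = P D * prob_power nu k C)%E.
Proof.
move=> mD mX PD C mC.
have PDge0 : 0 <= fine (P D) by rewrite fine_ge0.
have PDE : P D = (fine (P D))%:E by rewrite fineK// fin_num_measure.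
have mXt := measurable_mktuple mX.
pose X' : {mfun T >-> k.-tuple S} := HB.pack (fun w => [tuple X i w | i < k])
  (isMeasurableFun.Build _ _ _ _ _ mXt).
have boxP (B : 'I_k -> set S) :
    X' @^-1` box B = \bigcap_(i in setT) (X i @^-1` B i).
  apply/seteqP; split=> w /= wB i => [_|].
    by have := wB i; rewrite tnth_mktuple.
  by rewrite tnth_mktuple; exact: wB.
transitivity (mscale (NngNum PDge0) (prob_power nu k) C); last first.
  by rewrite /mscale/= -PDE.
apply: (@measure_unique _ R (k.-tuple S) [set C | exists2 B : 'I_k -> set S,
    forall i, measurable (B i) & C = box B] (fun=> setT) _ _ _ _
    (pushforward (mrestr P mD) X')) => //.
- exact: measurable_boxes.
- move=> _ _ [B mB ->] [B' mB' ->]; exists (fun i => B i `&` B' i) => [i|].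
    exact: measurableI.
  by apply/seteqP; split=> [x [xB xB'] i|x xB]; split=> // i; case: (xB i).
- move=> _; exists (fun=> setT) => //.
  by apply/seteqP; split.
- by rewrite bigcup_const//; exists 0%N.
- move=> _ [B mB ->].
  by rewrite /= /mscale /= prob_power_box// -PDE -PD// -boxP.
- move=> _; rewrite -[ltLHS]/(P (X' @^-1` setT `&` D)) preimage_setT setTI.
  by rewrite PDE ltry.
Qed.

Lemma integral_law_tuple d' (T : measurableType d') (P : probability T R)
    (D : set T) k (X : 'I_k -> T -> S) (f : k.-tuple S -> \bar R) :
  measurable D -> (forall i, measurable_fun setT (X i)) ->
  (forall B : 'I_k -> set S, (forall i, measurable (B i)) ->
    (P (\bigcap_i X i @^-1` B i `&` D) = P D * \prod_i nu (B i))%E) ->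
  measurable_fun [set: k.-tuple S] f -> (forall x, 0 <= f x)%E ->
  (\int[P]_(w in D) f [tuple X i w | i < k] =
   P D * \int[prob_power nu k]_x f x)%E.
Proof.
move=> mD mX PD mf f0.
have PDge0 : 0 <= fine (P D) by rewrite fine_ge0.
have PDE : P D = (fine (P D))%:E by rewrite fineK// fin_num_measure.
have mXt := measurable_mktuple mX.
pose X' : {mfun T >-> k.-tuple S} := HB.pack (fun w => [tuple X i w | i < k])
  (isMeasurableFun.Build _ _ _ _ _ mXt).
have mfX : measurable_fun setT (f \o X') by exact: measurableT_comp.
transitivity (\int[mrestr P mD]_(w in D) (f \o X') w)%E.
  apply: eq_measure_integral => A mA AD; rewrite /= /mrestr.
  by rewrite setIidl.
transitivity (\int[mrestr P mD]_w (f \o X') w)%E.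
  (* the restricted measure gives no mass to the complement of D *)
  rewrite [RHS](@ge0_negligible_integral _ _ _ _ _ (~` D))//=.
  - by rewrite setTD setCK.
  - exact: measurableC.
  - by rewrite /mrestr setICl.
transitivity (\int[mscale (NngNum PDge0) (prob_power nu k)]_x f x)%E.
  rewrite -[LHS](@ge0_integral_pushforward _ _ _ _ _ X' _ _ setT)//.
  apply: eq_measure_integral => C mC _.
  by rewrite /= /mscale /= -PDE -(law_tuple mD mX PD mC).
by rewrite ge0_integral_mscale//= -PDE.
Qed.

End power_law.

(** * Independent samples from a sequence *)

(** The two maps [f] and [g] are injective with disjoint images exactly
    when [joint f g] is injective, so one hypothesis covers both. *)
Definition joint (A B C : Type) (f : A -> C) (g : B -> C) (v : A + B) : C :=
  match v with inl a => f a | inr b => g b end.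

Section iid_tuples.
Context d (T : measurableType d) (R : realType) (P : probability T R).
Variables (nu : probability R R) (theta : nat -> {RV P >-> R}).
Hypothesis theta_iid : iid nu theta.

Lemma iid_bigcap (V : finType) (f : V -> nat) (B : V -> set R) :
  injective f -> (forall v, measurable (B v)) ->
  (P (\bigcap_v theta (f v) @^-1` B v) = \prod_v nu (B v))%E.
Proof.
move=> f_inj mB; have [law indep] := theta_iid.
(* mutual independence concerns families of sets indexed by all of nat *)
pose B' n := if [pick v | f v == n] is Some v then B v else setT.
have B'f v : B' (f v) = B v.
  by rewrite /B'; case: pickP => [w /eqP/f_inj ->//|/(_ v)]; rewrite eqxx.
have mB' n : measurable (B' n) by rewrite /B'; case: pickP.
have := indep (map f (enum V)) B' (etrans (map_inj_uniq f_inj _)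
  (enum_uniq V)) mB'.
rewrite big_map big_enum/= => E; rewrite (_ : \bigcap_v _ = \bigcap_(n in
    [set` map f (enum V)]) theta n @^-1` B' n); last first.
  apply/seteqP; split => [w wB _ /mapP[v _ ->]|w wB v _] /=.
    by rewrite B'f; exact: wB.
  rewrite -B'f; apply: (wB (f v)); apply/mapP; exists v => //.
  by rewrite mem_enum.
by rewrite E; apply: eq_bigr => v _; rewrite B'f -(law (f v)).
Qed.

Definition theta_tuple k (phi : 'I_k -> nat) (w : T) : k.-tuple R :=
  [tuple theta (phi i) w | i < k].

Lemma measurable_theta_tuple k (phi : 'I_k -> nat) :
  measurable_fun setT (theta_tuple phi).
Proof. by apply: measurable_mktuple => i; exact: measurable_funPT. Qed.

(** Boxes are upgraded to arbitrary measurable sets one tuple at a time: first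
    [D], with the event that the other tuple lies in a box held fixed, and then
    [C], with the event that the second tuple lies in [D] held fixed. *)
Lemma theta_tuple_indep k l (phi : 'I_k -> nat) (psi : 'I_l -> nat) C D :
  injective (joint phi psi) ->
  measurable C -> measurable D ->
  (P (theta_tuple phi @^-1` C `&` theta_tuple psi @^-1` D) =
   prob_power nu k C * prob_power nu l D)%E.
Proof.
move=> f_inj mC mD.
have mth i B : measurable B -> measurable (theta i @^-1` B).
  by move=> mB; rewrite -[X in measurable X]setTI; exact: measurable_funPT.
have mcap m (chi : 'I_m -> nat) B : (forall i, measurable (B i)) ->
    measurable (\bigcap_i theta (chi i) @^-1` B i).
  move=> mB; apply: fin_bigcap_measurable => [|i _]; first exact: finite_finset.
  exact: mth.
have phi_inj : injective phi by move=> i j /(f_inj (inl i) (inl j))[].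
have psi_inj : injective psi by move=> i j /(f_inj (inr i) (inr j))[].
have both (B : 'I_k -> set R) (B' : 'I_l -> set R) :
    (forall i, measurable (B i)) -> (forall j, measurable (B' j)) ->
    (P (\bigcap_i theta (phi i) @^-1` B i `&`
        \bigcap_j theta (psi j) @^-1` B' j) =
     \prod_i nu (B i) * \prod_j nu (B' j))%E.
  move=> mB mB'.
  pose BB := joint B B'.
  rewrite (_ : _ `&` _ = \bigcap_v theta (joint phi psi v) @^-1` BB v).
    by rewrite iid_bigcap// ?big_sumType// => -[].
  apply/seteqP; split => [w [wB wB'] [i|j] _|w wB]; [exact: wB|exact: wB'|].
  by split => i _; [exact: (wB (inl i))|exact: (wB (inr i))].
have half (B : 'I_k -> set R) : (forall i, measurable (B i)) ->
    (P (\bigcap_i theta (phi i) @^-1` B i `&` theta_tuple psi @^-1` D) =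
     \prod_i nu (B i) * prob_power nu l D)%E.
  move=> mB; rewrite setIC -(iid_bigcap phi_inj)//.
  apply: (@law_tuple _ _ _ nu _ _ P _ _ (fun j => theta (psi j))) => //.
    exact: mcap.
  by move=> B' mB'; rewrite setIC both// iid_bigcap.
have PD : P (theta_tuple psi @^-1` D) = prob_power nu l D.
  have := half (fun=> setT) (fun=> measurableT).
  rewrite big1 ?mul1e => [<-|i _]; last exact: probability_setT.
  by rewrite (_ : \bigcap_i _ = setT) ?setTI//; apply/seteqP; split.
rewrite muleC -PD.
apply: (@law_tuple _ _ _ nu _ _ P _ _ (fun i => theta (phi i))) => //.
  by rewrite -[X in measurable X]setTI; exact: measurable_theta_tuple.
by move=> B mB; rewrite half// PD muleC.
Qed.

Lemma expectation_theta_tuples k l (phi : 'I_k -> nat) (psi : 'I_l -> nat)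
    (u : k.-tuple R -> \bar R) (v : l.-tuple R -> \bar R) :
  injective (joint phi psi) ->
  measurable_fun [set: k.-tuple R] u -> (forall x, 0 <= u x)%E ->
  measurable_fun [set: l.-tuple R] v -> (forall x, 0 <= v x)%E ->
  (\int[P]_w (u (theta_tuple phi w) * v (theta_tuple psi w)) =
   \int[prob_power nu k]_x u x * \int[prob_power nu l]_x v x)%E.
Proof.
move=> f_inj mu u0 mv v0.
have mXY : measurable_fun setT (fun w => (theta_tuple phi w, theta_tuple psi w)).
  by apply/measurable_fun_pair => /=; exact: measurable_theta_tuple.
pose XY : {mfun T >-> (k.-tuple R * l.-tuple R)%type} :=
  HB.pack (fun w => (theta_tuple phi w, theta_tuple psi w))
    (isMeasurableFun.Build _ _ _ _ _ mXY).
pose h (z : k.-tuple R * l.-tuple R) := (u z.1 * v z.2)%E.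
have mh : measurable_fun setT h.
  by apply: emeasurable_funM; apply: measurableT_comp.
have h0 z : (0 <= h z)%E by exact: mule_ge0.
transitivity (\int[pushforward P XY]_z h z)%E.
  by rewrite ge0_integral_pushforward.
transitivity (\int[prob_power nu k \x prob_power nu l]_z h z)%E.
  apply: eq_measure_integral => A mA _; apply/esym.
  apply: (@product_measure_unique _ _ _ _ R (prob_power nu k) (prob_power nu l)
    (pushforward P XY)) => //.
  move=> C D mC mD; rewrite /pushforward; exact: theta_tuple_indep.
rewrite fubini_tonelli1// /fubini_F /h /=.
under eq_integral do rewrite ge0_integralZl//.
by rewrite ge0_integralZr//; exact: integral_ge0.
Qed.

Lemma expectation_theta_tuple k (phi : 'I_k -> nat) (u : k.-tuple R -> \bar R) :
  injective phi ->
  measurable_fun [set: k.-tuple R] u -> (forall x, 0 <= u x)%E ->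
  (\int[P]_w u (theta_tuple phi w) = \int[prob_power nu k]_x u x)%E.
Proof.
move=> phi_inj mu u0.
rewrite (@integral_law_tuple _ _ _ nu _ _ P setT _ (fun i => theta (phi i)))//.
  by rewrite probability_setT mul1e.
by move=> B mB; rewrite setIT probability_setT mul1e iid_bigcap.
Qed.

End iid_tuples.

(** * The kernel product of a labelled tuple *)

Lemma probability1_ae d (T : measurableType d) (R : realType)
    (P : probability T R) (A : set T) :
  measurable A -> P A = 1%E -> {ae P, forall w, A w}.
Proof.
move=> mA PA; exists (~` A); split => //; first exact: measurableC.
by rewrite probability_setC// PA subee.
Qed.

Lemma integral01 d (T : measurableType d) (R : realType)
    (P : probability T R) (f : T -> R) :
  measurable_fun setT (fun x => (f x)%:E) -> (forall x, 0 <= f x <= 1) ->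
  (0 <= \int[P]_x (f x)%:E <= 1)%E.
Proof.
move=> mf f01; have f0 x : (0 <= (f x)%:E)%E by case/andP: (f01 x).
apply/andP; split; first exact: integral_ge0.
apply: (@le_trans _ _ (\int[P]_x 1)%E).
  by apply: ge0_le_integral => // x _; rewrite lee_fin; case/andP: (f01 x).
by rewrite integral_cst// mul1e; exact: probability_le1.
Qed.

Lemma measurable_prod_cond d (T : measurableType d) (R : realType)
    (I : finType) (Q : pred I) (h : I -> T -> R) :
  (forall i, measurable_fun setT (h i)) ->
  measurable_fun setT (fun x => \prod_(i | Q i) h i x).
Proof.
move=> mh; under eq_fun do rewrite -big_filter.
by apply: measurable_prod => i _; exact: mh.
Qed.

Section weight.
Context (R : realType).

(** The variables theta and the first coordinates of the sample points lie in
    [0, 1] only almost surely. Clamping them makes every integrand bounded by 1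
    everywhere, and changes integrands only on null sets. *)
Definition clamp (x : R) : R := Num.max 0 (Num.min x 1).

Lemma clamp_id x : 0 <= x <= 1 -> clamp x = x.
Proof. by case/andP => x0 x1; rewrite /clamp min_l// max_r. Qed.

Lemma clamp01 x : 0 <= clamp x <= 1.
Proof. by rewrite /clamp le_max lexx/= ge_max ler01 ge_min lexx orbT. Qed.

Definition is_edge (F : Defs.fgraph) (e : 'I_(tag F) * 'I_(tag F)) : bool :=
  (e.1 < e.2)%N && adj (tagged F) e.1 e.2.

(** The kernel product over the edges of F at the points (s_i, t_i). It serves
    both with t_i in [0, 1] and with t_i an integer vertex label. *)
Definition weight (F : Defs.fgraph) (s t : 'I_(tag F) -> R) : R :=
  \prod_(e | is_edge e)
    Wker (clamp (s e.1), t e.1) (clamp (s e.2), t e.2).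

Lemma weight01 F (s t : 'I_(tag F) -> R) : 0 <= weight s t <= 1.
Proof.
suff W01 e : 0 <= Wker (clamp (s e.1), t e.1) (clamp (s e.2), t e.2) <= 1.
  apply/andP; split; first by apply: prodr_ge0 => e _; case/andP: (W01 e).
  by apply: prodr_ile1 => e _; exact: W01.
rewrite /Wker /=; case: ifP => _; first exact: clamp01.
by case: ifP => _; [exact: clamp01|rewrite lexx ler01].
Qed.

(** The kernel compares its second coordinates and does nothing else with them.
    This is what allows integer labels to replace points of [0, 1]. *)
Lemma eq_weight F (s t t' : 'I_(tag F) -> R) :
  (forall i j, (t i < t j) = (t' i < t' j)) -> weight s t = weight s t'.
Proof. by move=> tt'; apply: eq_bigr => e _; rewrite /Wker /= !tt'. Qed.

Lemma measurable_clamp : measurable_fun setT clamp.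
Proof. by apply: measurable_maxr => //; exact: measurable_minr. Qed.

Lemma measurable_weight F d (T : measurableType d) (s t : 'I_(tag F) -> T -> R) :
  (forall i, measurable_fun setT (s i)) ->
  (forall i, measurable_fun setT (t i)) ->
  measurable_fun setT (fun w => weight (s^~ w) (t^~ w)).
Proof.
move=> ms mt; apply: measurable_prod_cond => e; rewrite /Wker /=.
have mc i : measurable_fun setT (fun w => clamp (s i w)).
  by apply: measurableT_comp => //; exact: measurable_clamp.
apply: measurable_fun_ifT => //; first exact: measurable_fun_ltr.
by apply: measurable_fun_ifT => //; exact: measurable_fun_ltr.
Qed.

End weight.

(** * Probability that a map is a homomorphism *)

Section edge_probabilities.
Context d (T : measurableType d) (R : realType) (P : probability T R).
Variables (nu : probability R R) (theta : nat -> {RV P >-> R}).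
Variable Ginf : T -> sgraph nat.
Implicit Types F : Defs.fgraph.
Hypothesis nu01 : nu `[0, 1]%classic = 1%E.
Hypothesis theta_iid : iid nu theta.
Hypothesis Ginf_random : infinite_random_graph theta Ginf.

Lemma theta01 : {ae P, forall w n, 0 <= theta n w <= 1}.
Proof.
apply: (ae_foralln (P := fun n w => 0 <= theta n w <= 1)) => n.
have m01 : measurable (theta n @^-1` `[0, 1]).
  by rewrite -[X in measurable X]setTI; exact: measurable_funPT.
have := @probability1_ae _ _ _ P _ m01.
rewrite -[P _]/(distribution P (theta n) `[0, 1]).
rewrite (proj1 theta_iid)// => /(_ nu01); apply: filterS => w.
by rewrite /= in_itv.
Qed.

Lemma measurable_edge e : measurable [set w | adj (Ginf w) e.1 e.2].
Proof. by have [] := Ginf_random. Qed.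

(** Conditional independence, applied to the whole sample space. The condition
    that each edge lists its smaller endpoint first makes distinct entries of
    [L] distinct edges; the larger endpoint is the one whose theta counts. *)
Lemma probability_edges (L : seq (nat * nat)) :
  uniq L -> all (fun e => e.1 < e.2)%N L ->
  (P [set w | all (fun e => adj (Ginf w) e.1 e.2) L] =
   \int[P]_w (\prod_(e <- L) clamp (theta e.2 w))%:E)%E.
Proof.
move=> L_uniq L_lt; have [mE condE indepE] := Ginf_random.
have [|_] := indepE (fun e => theta (maxn e.1 e.2)) _ L L_uniq L_lt.
  by move=> e /= e12; apply: condE; rewrite neq_ltn e12.
move=> /(_ setT); rewrite setTI => E.
rewrite (_ : [set w | _] =
    \bigcap_(e in [set` L]) [set w | adj (Ginf w) e.1 e.2]); last first.
  apply/seteqP; split => [w /allP wL e /wL//|w wL]; apply/allP => e eL.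
  exact: wL.
rewrite E; last first.
  by rewrite -[setT]setD0; apply: sigma_algebraCD; exact: sigma_algebra0.
have mprod (g : nat -> nat -> T -> R) :
    (forall m n, measurable_fun setT (g m n)) ->
    measurable_fun setT (fun w => (\prod_(e <- L) g e.1 e.2 w)%:E).
  move=> mg; apply/measurable_EFinP.
  by apply: measurable_prod => e _; exact: mg.
apply: ae_eq_integral => //.
- by apply: (mprod (fun m n => theta (maxn m n))) => m n; exact: measurable_funPT.
- apply: (mprod (fun m n w => clamp (theta n w))) => m n.
  by apply: measurableT_comp; [exact: measurable_clamp|exact: measurable_funPT].
- apply: filterS theta01 => w w01 _; congr (_%:E).
  rewrite !big_seq; apply: eq_bigr => e eL.
  by rewrite clamp_id// (maxn_idPr _)// ltnW// (allP L_lt).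
Qed.

Definition image_edges F (phi : 'I_(tag F) -> nat) : seq (nat * nat) :=
  [seq (minn (phi e.1) (phi e.2), maxn (phi e.1) (phi e.2)) |
    e <- enum (@is_edge F)].

Lemma is_hom_image_edges F (phi : 'I_(tag F) -> nat) (G : sgraph nat) :
  is_hom (tagged F) G phi = all (fun e => adj G e.1 e.2) (image_edges phi).
Proof.
have minmax m n : adj G (minn m n) (maxn m n) = adj G m n.
  by case: leqP => // _; rewrite adj_sym.
apply/forallP/allP => [hom _ /mapP[e + ->]|hom i].
  rewrite mem_enum => /andP[_ e_adj]; rewrite /= minmax.
  by have /forallP/(_ e.2)/implyP := hom e.1; exact.
apply/forallP => j; apply/implyP => ij.
wlog ltij : i j ij / (i < j)%N => [H|].
  have [|ji|/val_inj eij] := ltngtP i j; first exact: H.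
    by rewrite adj_sym; apply: H => //; rewrite adj_sym.
  by move: ij; rewrite eij adj_irr.
rewrite -minmax; apply: (hom (minn (phi i) (phi j), maxn (phi i) (phi j))).
by apply/mapP; exists (i, j) => //; rewrite mem_enum unfold_in/= ltij.
Qed.

Lemma image_edges_lt F (phi : 'I_(tag F) -> nat) :
  injective phi -> all (fun e => e.1 < e.2)%N (image_edges phi).
Proof.
move=> phi_inj; apply/allP => _ /mapP[e + ->]; rewrite mem_enum => /andP[e12 _].
have : phi e.1 != phi e.2 by rewrite (inj_eq phi_inj) -val_eqE/= ltn_eqF.
by rewrite /= /minn /maxn; case: (ltngtP (phi e.1) (phi e.2)).
Qed.

Lemma image_edges_uniq F (phi : 'I_(tag F) -> nat) :
  injective phi -> uniq (image_edges phi).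
Proof.
move=> phi_inj; rewrite map_inj_in_uniq ?enum_uniq// => e e'.
rewrite !mem_enum => /andP[lt _] /andP[lt' _] [].
case: e e' lt lt' => [i j] [i' j'] /= lt lt'.
case: (ltnP (phi i) (phi j)) => _; case: (ltnP (phi i') (phi j')) => _.
- by move=> /phi_inj -> /phi_inj ->.
- by move=> /phi_inj ii /phi_inj jj; move: lt; rewrite ii jj ltnNge (ltnW lt').
- by move=> /phi_inj ii /phi_inj jj; move: lt; rewrite ii jj ltnNge (ltnW lt').
- by move=> /phi_inj -> /phi_inj ->.
Qed.

Definition label_weight F (phi : 'I_(tag F) -> nat) (x : (tag F).-tuple R) : R :=
  weight (fun i => tnth x i) (fun i => (phi i)%:R).

Lemma label_weight01 F (phi : 'I_(tag F) -> nat) x :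
  0 <= label_weight phi x <= 1.
Proof. exact: weight01. Qed.

Lemma label_weight_ge0 F (phi : 'I_(tag F) -> nat) x :
  (0 <= (label_weight phi x)%:E)%E.
Proof. by rewrite lee_fin; have /andP[] := label_weight01 phi x. Qed.

Lemma measurable_label_weight F (phi : 'I_(tag F) -> nat) :
  measurable_fun setT (fun x => (label_weight phi x)%:E).
Proof.
apply/measurable_EFinP/measurable_weight => i //.
exact: measurable_tnth.
Qed.

Lemma prod_image_edges F (phi : 'I_(tag F) -> nat) w : injective phi ->
  \prod_(e <- image_edges phi) clamp (theta e.2 w) =
  label_weight phi (theta_tuple theta phi w).
Proof.
move=> phi_inj; rewrite big_map big_enum /label_weight /weight.
apply: eq_bigr => e /andP[e12 _]; rewrite /Wker /= !tnth_mktuple !ltr_nat.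
have : phi e.1 != phi e.2 by rewrite (inj_eq phi_inj) -val_eqE/= ltn_eqF.
by case: ltngtP.
Qed.

(** For injective [phi] this is the probability that [phi] is a homomorphism to
    the random graph. It is defined for every [phi] because the average over all
    maps, not the one over injective maps, is an integral against the power of
    nu x lambda. *)
Definition mean_hom F (phi : 'I_(tag F) -> nat) : R :=
  fine (\int[prob_power nu (tag F)]_x (label_weight phi x)%:E).

Lemma mean_homE F (phi : 'I_(tag F) -> nat) :
  (\int[prob_power nu (tag F)]_x (label_weight phi x)%:E)%E = (mean_hom phi)%:E.
Proof.
have /andP[I0 I1] := integral01 (prob_power nu (tag F))
  (measurable_label_weight phi) (label_weight01 phi).
by rewrite fineK// ge0_fin_numE// (le_lt_trans I1)// ltry.
Qed.

Lemma mean_hom01 F (phi : 'I_(tag F) -> nat) : 0 <= mean_hom phi <= 1.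
Proof.
rewrite -!lee_fin -mean_homE; apply: integral01; last exact: label_weight01.
exact: measurable_label_weight.
Qed.

Lemma measurable_is_hom F (phi : 'I_(tag F) -> nat) :
  measurable [set w | is_hom (tagged F) (Ginf w) phi].
Proof.
rewrite (_ : [set w | _] = \bigcap_(e in [set` image_edges phi])
    [set w | adj (Ginf w) e.1 e.2]); last first.
  apply/seteqP; split => w /=; rewrite is_hom_image_edges.
    by move=> /allP wL e /wL.
  by move=> wL; apply/allP => e eL; exact: wL.
by apply: fin_bigcap_measurable => // e _; exact: measurable_edge.
Qed.

Lemma probability_is_hom F (phi : 'I_(tag F) -> nat) : injective phi ->
  P [set w | is_hom (tagged F) (Ginf w) phi] = (mean_hom phi)%:E.
Proof.
move=> phi_inj; under eq_set do rewrite is_hom_image_edges.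
rewrite probability_edges; [|exact: image_edges_uniq|exact: image_edges_lt].
under eq_integral do rewrite prod_image_edges//.
rewrite -mean_homE; apply: (expectation_theta_tuple theta_iid
    (u := fun x => (label_weight phi x)%:E) phi_inj).
  exact: measurable_label_weight.
by move=> x; exact: label_weight_ge0.
Qed.

(** Disjoint images make the two edge lists disjoint, so that conditional
    independence applies to their concatenation; and they make the two tuples of
    theta's independent, so that the resulting expectation factors. *)
Lemma probability_is_hom2 F F' (phi : 'I_(tag F) -> nat)
    (psi : 'I_(tag F') -> nat) :
  injective (joint phi psi) ->
  P ([set w | is_hom (tagged F) (Ginf w) phi] `&`
     [set w | is_hom (tagged F') (Ginf w) psi]) =
  (mean_hom phi * mean_hom psi)%:E.
Proof.
move=> f_inj.
have phi_inj : injective phi by move=> i j /(f_inj (inl i) (inl j))[].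
have psi_inj : injective psi by move=> i j /(f_inj (inr i) (inr j))[].
rewrite (_ : _ `&` _ = [set w | all (fun e => adj (Ginf w) e.1 e.2)
    (image_edges phi ++ image_edges psi)]); last first.
  by apply/seteqP; split => w /=; rewrite all_cat -!is_hom_image_edges => /andP.
rewrite probability_edges; last 2 first.
- rewrite cat_uniq !image_edges_uniq//= andbT; apply/hasPn.
  move=> _ /mapP[e' _ ->]; apply/mapP => -[e _ [_]].
  have [i ->] : exists i, maxn (phi e.1) (phi e.2) = phi i.
    by case: leqP => _; [exists e.2|exists e.1].
  have [j ->] : exists j, maxn (psi e'.1) (psi e'.2) = psi j.
    by case: leqP => _; [exists e'.2|exists e'.1].
  by move=> /(f_inj (inr j) (inl i)).
- by rewrite all_cat !image_edges_lt.
under eq_integral do rewrite big_cat/= !prod_image_edges// EFinM.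
rewrite (@expectation_theta_tuples _ _ _ _ _ _ theta_iid _ _ phi psi
  (fun x => (label_weight phi x)%:E) (fun x => (label_weight psi x)%:E))//.
- by rewrite !mean_homE.
- exact: measurable_label_weight.
- by move=> x; exact: label_weight_ge0.
- exact: measurable_label_weight.
- by move=> x; exact: label_weight_ge0.
Qed.

End edge_probabilities.

(** * The average of the means converges to the kernel density *)

Section average_limit.
Context (R : realType) (nu : probability R R).
Hypothesis nu01 : nu `[0, 1]%classic = 1%E.
Implicit Types F : Defs.fgraph.

Let mu : probability (R * R)%type R := mu_nu nu.

Lemma mu_nuX (A B : set R) : measurable A -> measurable B ->
  (mu (A `*` B) = nu A * lebesgue01 B)%E.
Proof. exact: product_measure1E. Qed.

Lemma lebesgue01_sub (a b : R) : 0 <= a -> a <= b -> b <= 1 ->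
  lebesgue01 `[a, b[%classic = (b - a)%:E.
Proof.
move=> a0 ab b1; rewrite /lebesgue01 /mrestr setIidl.
  rewrite lebesgue_measure_itv/= lte_fin.
  by move: ab; rewrite le_eqVlt => /predU1P[->|->//]; rewrite ltxx subrr.
move=> x; rewrite /= !in_itv/= => /andP[ax xb].
by rewrite (le_trans a0 ax) (ltW (lt_le_trans xb b1)).
Qed.

Lemma mu_power_ae k : {ae prob_power mu k, forall x, forall i,
  0 <= (tnth x i).1 <= 1 /\ 0 <= (tnth x i).2 < 1}.
Proof.
pose Q : set (R * R) := `[0, 1] `*` `[0, 1[.
have mQ : measurable Q by exact: measurableX.
have := @probability1_ae _ _ _ (prob_power mu k) (box (fun=> Q)) _ _.
have -> : (prob_power mu k (box (fun=> Q)) = 1)%E.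
  rewrite prob_power_box// big1// => i _; rewrite mu_nuX// nu01 mul1e.
  by rewrite lebesgue01_sub// subr0.
move=> /(_ (measurable_box (fun=> mQ)) erefl); apply: filterS => x xQ i.
by have [] := xQ i; rewrite /= !in_itv/=.
Qed.

Definition cell (n a : nat) : set R := [set` `[a%:R / n%:R, a.+1%:R / n%:R[ ].

Lemma cellE n a t : (0 < n)%N ->
  cell n a t <-> a%:R <= t * n%:R < a.+1%:R.
Proof.
move=> n0; rewrite /cell /= in_itv/= ler_pdivrMr ?ltr0n//.
by rewrite ltr_pdivlMr ?ltr0n.
Qed.

Lemma measurable_cell n a : measurable (cell n a).
Proof. exact: measurable_itv. Qed.

Lemma cell_inj n a b t : (0 < n)%N -> cell n a t -> cell n b t -> a = b.
Proof.
move=> n0 /(cellE _ _ n0)/andP[at1 at2] /(cellE _ _ n0)/andP[bt1 bt2].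
have ab : (a < b.+1)%N by rewrite -(ltr_nat R) (le_lt_trans at1 bt2).
have ba : (b < a.+1)%N by rewrite -(ltr_nat R) (le_lt_trans bt1 at2).
by apply/eqP; rewrite eqn_leq; apply/andP; split.
Qed.

Lemma lebesgue01_cell n (a : 'I_n) : lebesgue01 (cell n a) = n%:R^-1%:E :> \bar R.
Proof.
have n0 : (0 < n)%N by case: n a => // -[].
rewrite lebesgue01_sub.
- by rewrite -mulrBl -natr1 addrAC subrr add0r mul1r.
- by rewrite divr_ge0.
- by rewrite ler_pM2r ?invr_gt0 ?ltr0n// ler_nat.
- by rewrite ler_pdivrMr ?ltr0n// mul1r ler_nat.
Qed.

Definition cells n k (phi : 'I_k -> 'I_n) : set (k.-tuple (R * R)) :=
  box (fun i => setT `*` cell n (phi i)).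

Lemma measurable_cells n k (phi : 'I_k -> 'I_n) : measurable (cells phi).
Proof.
by apply: measurable_box => i; apply: measurableX => //; exact: measurable_cell.
Qed.

Definition fst_tuple k (x : k.-tuple (R * R)) : k.-tuple R :=
  [tuple (tnth x i).1 | i < k].

Lemma measurable_fst_tnth k i :
  measurable_fun setT (fun x : k.-tuple (R * R) => (tnth x i).1).
Proof. by apply: measurableT_comp => //; exact: measurable_tnth. Qed.

Lemma measurable_snd_tnth k i :
  measurable_fun setT (fun x : k.-tuple (R * R) => (tnth x i).2).
Proof. by apply: measurableT_comp => //; exact: measurable_tnth. Qed.

(** On [cells phi] only the second coordinates of the sample points are
    constrained, and they are independent of the first ones; each lies in its
    cell with probability 1/n. *)
Lemma integral_cells F n (phi : 'I_(tag F) -> 'I_n) :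
  (\int[prob_power mu (tag F)]_(x in cells phi)
     (label_weight phi (fst_tuple x))%:E =
   ((n%:R ^- tag F) * mean_hom nu phi)%:E)%E.
Proof.
have cellsE (B : 'I_(tag F) -> set R) : (forall i, measurable (B i)) ->
    (prob_power mu (tag F) (box (fun i => B i `*` cell n (phi i))) =
     \prod_i nu (B i) * (n%:R ^- tag F)%:E)%E.
  move=> mB; rewrite prob_power_box => [|i]; last first.
    by apply: measurableX; [exact: mB|exact: measurable_cell].
  under eq_bigr => i _ do
    rewrite (mu_nuX (mB i) (measurable_cell _ _)) (lebesgue01_cell (phi i)).
  rewrite big_split/=; congr (_ * _)%E.
  by rewrite prodEFin prodr_const card_ord exprVn.
have cellsT : prob_power mu (tag F) (cells phi) = (n%:R ^- tag F)%:E.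
  rewrite /cells cellsE// big1 ?mul1e// => i _; exact: probability_setT.
rewrite (@integral_law_tuple _ _ _ nu _ _ _ _ _
  (fun i x => (tnth x i).1) (fun x => (label_weight phi x)%:E)).
- by rewrite cellsT mean_homE.
- exact: measurable_cells.
- by move=> i; exact: measurable_fst_tnth.
- move=> B mB; rewrite cellsT muleC -cellsE//; congr (prob_power _ _ _).
  apply/seteqP; split => [x [xB xc] i|x xBc].
    by split; [exact: xB|case: (xc i)].
  by split=> i; [move=> _; case: (xBc i)|split=> //; case: (xBc i)].
- exact: measurable_label_weight.
- by move=> x; exact: label_weight_ge0.
Qed.

Definition mean_density F n : R :=
  (\sum_(phi : {ffun 'I_(tag F) -> 'I_n}) mean_hom nu (fun i => phi i)) /
  n%:R ^+ tag F.

(** The kernel product in which each second coordinate is replaced by the index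
    of its cell. Writing it as a sum over [phi] of functions supported on
    disjoint sets makes its integral a sum over [phi]. *)
Definition rounded_weight F n (x : (tag F).-tuple (R * R)) : \bar R :=
  (\sum_(phi : {ffun 'I_(tag F) -> 'I_n})
     ((fun x => (label_weight (fun i => phi i) (fst_tuple x))%:E) \_
      (cells phi)) x)%E.

Lemma measurable_label_weight_fst F (phi : 'I_(tag F) -> nat) :
  measurable_fun setT (fun x : (tag F).-tuple (R * R) =>
    (label_weight phi (fst_tuple x))%:E).
Proof.
apply: (@measurableT_comp _ _ _ _ _ _ (fun x => (label_weight phi x)%:E) _
  (@fst_tuple _)); first exact: measurable_label_weight.
by apply: measurable_mktuple => i; exact: measurable_fst_tnth.
Qed.

Lemma measurable_rounded_weight F n :
  measurable_fun [set: (tag F).-tuple (R * R)] (@rounded_weight F n).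
Proof.
apply: emeasurable_sum => phi.
apply/(measurable_restrictT _ (measurable_cells phi)).
exact: measurable_funTS (measurable_label_weight_fst _).
Qed.

Lemma integral_rounded_weight F n :
  (\int[prob_power mu (tag F)]_x rounded_weight n x = (mean_density F n)%:E)%E.
Proof.
rewrite ge0_integral_sum//; last 2 first.
- move=> phi; apply/(measurable_restrictT _ (measurable_cells phi)).
  exact: measurable_funTS (measurable_label_weight_fst _).
- move=> phi x _; apply: erestrict_ge0 => y _; exact: label_weight_ge0.
under eq_bigr => phi _ do rewrite -integral_mkcond integral_cells.
rewrite sumEFin; congr (_%:E).
by rewrite /mean_density mulrC mulr_sumr.
Qed.

Lemma rounded_weightE F n (phi : {ffun 'I_(tag F) -> 'I_n}) x : (0 < n)%N ->
  cells phi x ->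
  rounded_weight n x = (label_weight (fun i => phi i) (fst_tuple x))%:E.
Proof.
move=> n0 x_phi; rewrite /rounded_weight (bigD1 phi)//= patchE mem_set//.
rewrite big1 ?adde0// => psi psi_phi; rewrite patchE memNset// => x_psi.
case/eqP: psi_phi; apply/ffunP => i; apply: val_inj.
by apply: cell_inj n0 _ _; [exact: (x_psi i).2|exact: (x_phi i).2].
Qed.

Lemma rounded_weight_le1 F n (x : (tag F).-tuple (R * R)) : (0 < n)%N ->
  (`|rounded_weight n x| <= 1)%E.
Proof.
move=> n0; have [[phi x_phi]|nx] :=
  pselect (exists phi : {ffun 'I_(tag F) -> 'I_n}, cells phi x).
  rewrite (rounded_weightE n0 x_phi) abse_EFin lee_fin.
  by have /andP[w0 w1] := label_weight01 (fun i => phi i) (fst_tuple x);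
    rewrite ger0_norm.
rewrite /rounded_weight big1 ?abse0// => phi _; rewrite patchE memNset// => x_phi.
by apply: nx; exists phi.
Qed.

(** Once n exceeds the inverse of every positive gap between two of the t's,
    distinct t's lie in distinct cells, while equal t's always share one. So the
    sequence is eventually constant. *)
Lemma cvg_rounded_weight F (x : (tag F).-tuple (R * R)) :
  (forall i, 0 <= (tnth x i).2 < 1) ->
  (fun n => rounded_weight n.+1 x) @ \oo -->
  (weight (fun i => (tnth x i).1) (fun i => (tnth x i).2))%:E.
Proof.
move=> x01; apply: cvg_near_cst.
have sep : \forall n \near \oo, forall i j : 'I_(tag F),
    (tnth x i).2 < (tnth x j).2 -> 1 < ((tnth x j).2 - (tnth x i).2) * n.+1%:R.
  apply: filter_forall => i; apply: filter_forall => j.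
  have [ij|ji] := ltP (tnth x i).2 (tnth x j).2; last by apply: nearW.
  near=> n => _; rewrite -ltr_pdivrMl ?subr_gt0// mulr1.
  have : ((tnth x j).2 - (tnth x i).2)^-1 < n%:R by near: n; exact: nbhs_infty_gtr.
  by move=> /lt_trans; apply; rewrite ltr_nat.
apply: filterS sep => n sep.
have phiP i : (Num.truncn ((tnth x i).2 * n.+1%:R) < n.+1)%N.
  have /andP[t0 t1] := x01 i.
  have /truncn_itv/andP[le_t _] : 0 <= (tnth x i).2 * n.+1%:R by rewrite mulr_ge0.
  by rewrite -(ltr_nat R) (le_lt_trans le_t)// gtr_pMl.
pose phi := [ffun i => Ordinal (phiP i)].
have x_phi : cells phi x.
  move=> i; split => //; apply/cellE => //; rewrite ffunE /=.
  by have /andP[t0 t1] := x01 i; rewrite truncn_itv// mulr_ge0.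
rewrite (rounded_weightE _ x_phi)//; congr (_%:E).
rewrite /label_weight; under eq_fun do rewrite tnth_mktuple.
apply: eq_weight => i j; rewrite ltr_nat.
have /(cellE _ _ (ltn0Sn n))/andP[i1 i2] := (x_phi i).2.
have /(cellE _ _ (ltn0Sn n))/andP[j1 j2] := (x_phi j).2.
apply/idP/idP => [|/sep]; last first.
  rewrite mulrBl ltrBrDr => ij; rewrite -(ltr_nat R) -(ltrD2r 1).
  rewrite [ltRHS]natr1; apply: lt_trans j2; apply: le_lt_trans ij.
  by rewrite addrC lerD2l.
apply: contraTT; rewrite -leNgt -leqNgt => ji.
rewrite -ltnS -(ltr_nat R); apply: le_lt_trans i2; apply: le_trans j1 _.
by rewrite ler_wpM2r.
Unshelve. all: by end_near.
Qed.

Definition pair_weight F (x : (tag F).-tuple (R * R)) : R :=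
  weight (fun i => (tnth x i).1) (fun i => (tnth x i).2).

Lemma measurable_pair_weight F :
  measurable_fun setT (fun x => (@pair_weight F x)%:E).
Proof.
apply/measurable_EFinP/measurable_weight => i.
  exact: measurable_fst_tnth.
exact: measurable_snd_tnth.
Qed.

Lemma kernel_density_weight F : (kernel_density mu (@Wker R) F)%:E =
  (\int[prob_power mu (tag F)]_x (pair_weight x)%:E)%E.
Proof.
have /andP[I0 I1] := integral01 (prob_power mu (tag F))
  (@measurable_pair_weight F) (fun x => weight01 _ _).
rewrite -[RHS]fineK; last by rewrite ge0_fin_numE// (le_lt_trans I1)// ltry.
congr (_%:E); rewrite /kernel_density /Rintegral; congr fine.
apply: ae_eq_integral => //; [|exact: measurable_pair_weight|].
  apply/measurable_EFinP/measurable_prod_cond => e; rewrite /Wker.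
  apply: measurable_fun_ifT; first by apply: measurable_fun_ltr; exact: measurable_snd_tnth.
    exact: measurable_fst_tnth.
  apply: measurable_fun_ifT => //; last exact: measurable_fst_tnth.
  by apply: measurable_fun_ltr; exact: measurable_snd_tnth.
apply: filterS (mu_power_ae (tag F)) => x x01 _; congr (_%:E).
apply: eq_bigr => e _; rewrite /Wker /=.
by rewrite !clamp_id; [| exact: (x01 _).1..].
Qed.

(** Dominated convergence. The index is shifted because the cells make sense
    only for positive n. *)
Lemma cvg_mean_density F :
  mean_density F @ \oo --> kernel_density mu (@Wker R) F.
Proof.
rewrite -(cvg_shiftS (mean_density F)).
have [|||_ _] := @dominated_convergence _ _ _ (prob_power mu (tag F)) setT
  measurableT (fun n => @rounded_weight F n.+1) _ (cst 1%E)
  (fun n => @measurable_rounded_weight F n.+1) (@measurable_pair_weight F).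
- apply: filterS (mu_power_ae (tag F)) => x x01 _.
  by apply: cvg_rounded_weight => i; exact: (x01 i).2.
- exact: finite_measure_integrable_cst.
- by apply: aeW => x n _; exact: rounded_weight_le1.
rewrite -kernel_density_weight.
under eq_fun do rewrite integral_rounded_weight.
by move=> /fine_cvg.
Qed.

Lemma kernel_density01 F : 0 <= kernel_density mu (@Wker R) F <= 1.
Proof.
rewrite -!lee_fin kernel_density_weight; apply: integral01 => [|x].
  exact: measurable_pair_weight.
exact: weight01.
Qed.

End average_limit.

(** * Concentration of the homomorphism densities *)

(** A bound on the number of non-injective maps from an m-set to an n-set,
    multiplied by n to avoid the exponent m - 1. *)
Lemma expn_le_ffact n m : (n ^ m * n <= n ^_ m * n + m * m * n ^ m)%N.
Proof.
elim: m => [|m IH]; first by rewrite expn0 ffactn0 leq_addr.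
have le_exp : (n ^_ m <= n ^ m)%N.
  rewrite -{1}(card_ord n) -{1}(card_ord m) -card_inj_ffuns.
  by rewrite (leq_trans (max_card _))// card_ffun !card_ord.
rewrite ffactnSr expnSr; set a := (n ^_ m)%N in le_exp IH *.
set b := (n ^ m)%N in le_exp IH *.
have : (a * n <= a * (n - m) + m * b)%N.
  have : (n <= n - m + m)%N by lia.
  by nia.
nia.
Qed.

Lemma cvg_invn (R : realType) : (fun n => n%:R^-1 : R) @ \oo --> 0.
Proof. by rewrite -(cvg_shiftS (fun n => n%:R^-1 : R)); exact: cvg_harmonic. Qed.

Lemma covariance0 d (T : measurableType d) (R : realType)
    (P : probability T R) (A B : set T) (a b : R) :
  measurable A -> measurable B -> P A = a%:E -> P B = b%:E ->
  P (A `&` B) = (a * b)%:E ->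
  (\int[P]_w ((\1_A w - a) * (\1_B w - b))%:E = 0)%E.
Proof.
move=> mA mB PA PB PAB.
have L1 C : measurable C -> \1_C \in Lfun P 1.
  by move=> mC; apply/Lfun1_integrable; exact: integrable_indic.
have : covariance P \1_A \1_B = 0%E.
  have AB : \1_A * \1_B = \1_(A `&` B) :> (T -> R) by rewrite indicI.
  have mAB : measurable (A `&` B) by exact: measurableI.
  rewrite covarianceE ?AB ?L1// !expectation_indic// PAB PA PB -EFinM subee//.
by rewrite covariance.unlock !expectation_indic// PA PB unlock.
Qed.

Section finite_graphs.
Variable n : nat.

Definition adj_table (G : sgraph 'I_n) : {ffun 'I_n * 'I_n -> bool} :=
  [ffun e => adj G e.1 e.2].

Lemma adj_table_inj : injective adj_table.
Proof.
move=> [a aS aI] [b bS bI] /ffunP ab.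
have {}ab : a = b.
  by apply/funext => i; apply/funext => j; have := ab (i, j); rewrite !ffunE.
by case: _ / ab bS bI => bS bI; congr SGraph; exact: Prop_irrelevance.
Qed.

(** The induced subgraph takes finitely many values, each on an event determined
    by finitely many edges; so every property of it is an event, including those
    stated through the distance, a supremum over all graphs. *)
Lemma measurable_prefix d (T : measurableType d) (Ginf : T -> sgraph nat)
    (Q : sgraph 'I_n -> Prop) :
  (forall e, measurable [set w | adj (Ginf w) e.1 e.2]) ->
  measurable [set w | Q (induced_prefix n (Ginf w))].
Proof.
move=> mE.
have mtable f : measurable [set w | adj_table (induced_prefix n (Ginf w)) = f].
  rewrite (_ : [set w | _] = \bigcap_e
      [set w | adj (Ginf w) (e.1 : 'I_n) (e.2 : 'I_n) = f e]).
    apply: fin_bigcap_measurable => [|e _]; first exact: finite_finset.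
    have := mE (e.1 : nat, e.2 : nat); case: (f e) => //= /measurableC.
    congr measurable; apply/seteqP; split => w /=; first by move/negP/negbTE.
    by move=> ->.
  apply/seteqP; split => [w <- e _|w wf]; first by rewrite /= ffunE.
  by apply/ffunP => e; rewrite ffunE; exact: wf.
rewrite (_ : [set w | _] =
    \bigcup_(f in [set f | exists2 G, adj_table G = f & Q G])
      [set w | adj_table (induced_prefix n (Ginf w)) = f]).
  by apply: fin_bigcup_measurable => [|f _]; [exact: finite_finset|exact: mtable].
apply/seteqP; split => [w Qw|w [f [G <- QG]] /= /adj_table_inj ->//].
exists (adj_table (induced_prefix n (Ginf w))) => //.
by exists (induced_prefix n (Ginf w)).
Qed.

End finite_graphs.

Section second_moment.
Context d (T : measurableType d) (R : realType) (P : probability T R).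
Variables (nu : probability R R) (theta : nat -> {RV P >-> R}).
Variable Ginf : T -> sgraph nat.
Hypothesis nu01 : nu `[0, 1]%classic = 1%E.
Hypothesis theta_iid : iid nu theta.
Hypothesis Ginf_random : infinite_random_graph theta Ginf.
Variable F : Defs.fgraph.

Let k := tag F.

Definition joint_map n (phi psi : {ffun 'I_k -> 'I_n}) :
  {ffun 'I_k + 'I_k -> 'I_n} := [ffun v => joint phi psi v].

(** Pairs of maps embed into maps on the disjoint union of the vertex sets,
    among which the injective ones are counted by a falling factorial. *)
Lemma card_noninjective_pairs n :
  (#|[pred p | ~~ injectiveb (@joint_map n p.1 p.2)]| * n <=
   (k + k) * (k + k) * n ^ (k + k))%N.
Proof.
have card_inj := card_inj_ffuns ('I_k + 'I_k)%type 'I_n.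
rewrite card_sum !card_ord in card_inj.
have card_all : #|{ffun 'I_k + 'I_k -> 'I_n}| = (n ^ (k + k))%N.
  by rewrite card_ffun card_sum !card_ord.
have join_inj : injective (fun p => @joint_map n p.1 p.2).
  move=> [phi psi] [phi' psi'] /ffunP join_eq; congr (_, _); apply/ffunP => i.
    by have := join_eq (inl i); rewrite !ffunE.
  by have := join_eq (inr i); rewrite !ffunE.
have le_card : (#|[pred p | ~~ injectiveb (@joint_map n p.1 p.2)]| + n ^_ (k + k)
    <= n ^ (k + k))%N.
  rewrite -card_inj -card_all.
  rewrite -[X in (_ <= X)%N](cardsC
    [set f : {ffun _ -> _} | injectiveb f]%SET) addnC leq_add2l.
  rewrite -(fintype.card_image join_inj); apply: subset_leq_card.
  by apply/fintype.subsetP => f /fintype.imageP[p + ->]; rewrite !inE.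
have := expn_le_ffact n (k + k); nia.
Qed.

Definition hom_event n (phi : {ffun 'I_k -> 'I_n}) : set T :=
  [set w | is_hom (tagged F) (Ginf w) (fun i => phi i : nat)].

Definition hom_deviation n (phi : {ffun 'I_k -> 'I_n}) (w : T) : R :=
  \1_(hom_event phi) w - mean_hom nu (fun i => phi i : nat).

Lemma measurable_hom_event n (phi : {ffun 'I_k -> 'I_n}) :
  measurable (hom_event phi).
Proof. exact: (measurable_is_hom Ginf_random). Qed.

Lemma measurable_hom_deviation n (phi : {ffun 'I_k -> 'I_n}) :
  measurable_fun setT (hom_deviation phi).
Proof.
by apply: measurable_funB => //; apply: measurable_indic; exact: measurable_hom_event.
Qed.

Lemma hom_deviation_le1 n (phi : {ffun 'I_k -> 'I_n}) w :
  `|hom_deviation phi w| <= 1.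
Proof.
have /andP[m0 m1] := mean_hom01 nu (fun i => phi i : nat).
rewrite /hom_deviation indicE ler_norml; case: (_ \in _) => /=; lra.
Qed.

Lemma integrable_deviation2 n (phi psi : {ffun 'I_k -> 'I_n}) :
  P.-integrable setT (fun w => (hom_deviation phi w * hom_deviation psi w)%:E).
Proof.
apply: (le_integrable measurableT _ _ (finite_measure_integrable_cst P 1 measurableT)).
  apply/measurable_EFinP; apply: measurable_funM; exact: measurable_hom_deviation.
move=> w _; rewrite /= lee_fin normr1 normrM.
by rewrite mulr_ile1// hom_deviation_le1.
Qed.

(** For a jointly injective pair the deviations are centred and independent, so
    the integral vanishes; otherwise the integrand is bounded by 1. *)
Lemma integral_deviation2_le n (phi psi : {ffun 'I_k -> 'I_n}) :
  (\int[P]_w (hom_deviation phi w * hom_deviation psi w)%:E <=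
   (~~ injectiveb (joint_map phi psi))%:R%:E)%E.
Proof.
case: (boolP (injectiveb _)) => [/injectiveP inj|_]; last first.
  apply: (@le_trans _ _ (\int[P]_w 1)%E).
    apply: le_integral => //; first exact: integrable_deviation2.
      exact: (finite_measure_integrable_cst P 1 measurableT).
    move=> w _; rewrite lee_fin (le_trans (ler_norm _))// normrM.
    by rewrite mulr_ile1// hom_deviation_le1.
  by rewrite integral_cst// mul1e; exact: probability_le1.
have f_inj : injective (joint (fun i => phi i : nat) (fun j => psi j : nat)).
  move=> u v uv; apply: inj; apply: val_inj.
  by rewrite !ffunE; case: u v uv => [i|i] [j|j].
rewrite covariance0//; try exact: measurable_hom_event.
- apply: (probability_is_hom nu01 theta_iid Ginf_random) => i j.
  by move=> /(f_inj (inl i) (inl j))[].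
- apply: (probability_is_hom nu01 theta_iid Ginf_random) => i j.
  by move=> /(f_inj (inr i) (inr j))[].
- exact: (probability_is_hom2 nu01 theta_iid Ginf_random f_inj).
Qed.

Definition density_deviation n (w : T) : R :=
  hom_density R F (induced_prefix n (Ginf w)) - mean_density nu F n.

Lemma density_deviationE n w :
  density_deviation n w = n%:R ^- k * \sum_phi @hom_deviation n phi w.
Proof.
rewrite /density_deviation /hom_density /mean_density card_ffun !card_ord natrX.
rewrite -mulrBl mulrC; congr (_ * _); rewrite big_split/= sumrN; congr (_ - _).
rewrite -sum1_card natr_sum big_mkcond; apply: eq_bigr => phi _.
by rewrite indicE (_ : (phi \in _) = (w \in hom_event phi)); [case: (_ \in _)|].
Qed.

Lemma expectation_density_deviation2 n : (0 < n)%N ->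
  (\int[P]_w (density_deviation n w ^+ 2)%:E <=
   ((k + k) * (k + k))%N%:R%:E * n%:R^-1%:E)%E.
Proof.
move=> n0; have n0' : 0 < n%:R :> R by rewrite ltr0n.
(* c is the inverse of the number of pairs of maps *)
pose c : R := n%:R ^- (k + k).
have c0 : 0 <= c by rewrite invr_ge0 exprn_ge0.
have sq w : (density_deviation n w ^+ 2)%:E = (\sum_(p : {ffun 'I_k -> 'I_n} *
    {ffun 'I_k -> 'I_n}) (c%:E * (hom_deviation p.1 w * hom_deviation p.2 w)%:E))%E.
  under eq_bigr do rewrite -EFinM.
  rewrite sumEFin density_deviationE; congr (_%:E).
  rewrite exprMn -mulr_sumr; congr (_ * _); first by rewrite /c exprD invfM expr2.
  by rewrite expr2 big_distrlr/= pair_big.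
under eq_integral do rewrite sq.
rewrite integral_sum//; last first.
  by move=> p; apply: integrableZl => //; exact: integrable_deviation2.
apply: (@le_trans _ _ (\sum_(p : {ffun 'I_k -> 'I_n} * {ffun 'I_k -> 'I_n})
   (c * (~~ injectiveb (joint_map p.1 p.2))%:R)%:E)%E).
  apply: lee_sum => p _; rewrite integralZl//; last exact: integrable_deviation2.
  by rewrite EFinM lee_wpmul2l ?lee_fin// integral_deviation2_le.
rewrite sumEFin -mulr_sumr -EFinM lee_fin -natr_sum -big_mkcond sum1_card.
have := card_noninjective_pairs n; rewrite -(ler_nat R) [in leLHS]natrM
  [in leRHS]natrM natrX => le_card.
rewrite /c ler_pdivlMr// -mulrA ler_pdivrMl ?exprn_gt0//.
rewrite [leRHS]mulrC; exact: le_trans le_card.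
Qed.

Lemma probability_density_deviation n (delta : R) : (0 < n)%N -> 0 < delta ->
  (P [set w | (delta <= `|density_deviation n w|)%R] <=
   (delta ^- 2 * ((k + k) * (k + k))%N%:R / n%:R)%:E)%E.
Proof.
move=> n0 delta0.
have mZ : measurable_fun setT (density_deviation n).
  have /funext -> := @density_deviationE n.
  apply: measurable_funM => //.
  by apply: measurable_sum => phi; exact: measurable_hom_deviation.
pose Z : {RV P >-> R} :=
  HB.pack (density_deviation n) (isMeasurableFun.Build _ _ _ _ _ mZ).
have := @markov _ _ _ P Z (fun x => x ^+ 2) delta delta0.
move=> /(_ _ _ _)/le_trans H.
rewrite -mulrA EFinM lee_pdivlMl ?exprn_gt0//.
apply: H.
- exact: measurable_funX.
- by move=> r _; exact: sqr_ge0.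
- by move=> x y; rewrite !nnegrE => x0 y0; rewrite ler_sqr.
rewrite unlock /=; under eq_integral do rewrite real_normK ?num_real//.
by rewrite EFinM; exact: expectation_density_deviation2.
Qed.

Lemma cvg_hom_density_prob (delta : R) : 0 < delta ->
  P [set w | delta < `|hom_density R F (induced_prefix n (Ginf w)) -
    kernel_density (mu_nu nu) (@Wker R) F|] @[n --> \oo] --> 0%E.
Proof.
move=> delta0; pose kd := kernel_density (mu_nu nu) (@Wker R) F.
pose C : R := (delta / 2) ^- 2 * ((k + k) * (k + k))%N%:R.
have C_cvg : (fun n => (C / n%:R)%:E : \bar R) @ \oo --> 0%E.
  apply: cvg_EFin; first exact: nearW.
  rewrite -[0 in X in _ --> X](mulr0 C); apply: cvgMr => //.
  exact: cvg_invn.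
apply: (squeeze_cvge _ (cvg_cst 0%E) C_cvg).
have mean_near : \forall n \near \oo, `|kd - mean_density nu F n| < delta / 2.
  have /cvgrPdist_lt := @cvg_mean_density _ _ nu01 F; apply.
  by rewrite divr_gt0.
near=> n; have n0 : (0 < n)%N by near: n; exact: nbhs_infty_gt.
rewrite measure_ge0/=.
have delta20 : 0 < delta / 2 by rewrite divr_gt0.
apply: le_trans (probability_density_deviation n0 delta20).
have mE := measurable_edge Ginf_random.
apply: le_measure.
- rewrite inE; exact: (measurable_prefix (n := n) (Ginf := Ginf)
    (fun G => delta < `|hom_density R F G - kd|)).
- rewrite inE; exact: (measurable_prefix (n := n) (Ginf := Ginf)
    (fun G => delta / 2 <= `|hom_density R F G - mean_density nu F n|)).
move=> w /= dev; rewrite leNgt; apply/negP => dev2; move: dev.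
apply/negP; rewrite -leNgt -/kd.
rewrite -[leLHS]distrC -(subrKA (mean_density nu F n)).
rewrite (le_trans (ler_normD _ _))// (splitr delta) lerD// ltW//.
  by near: n.
by rewrite distrC.
Unshelve. all: by end_near.
Qed.

End second_moment.

(** * Convergence in the metric *)

Lemma hom_density01 (R : realType) (F : Defs.fgraph) (V : finType) (G : sgraph V) :
  0 <= hom_density R F G <= 1.
Proof.
rewrite /hom_density divr_ge0//=.
have [->|] := eqVneq #|{ffun 'I_(tag F) -> V}| 0%N; first by rewrite invr0 mulr0.
rewrite -lt0n => card_gt0.
by rewrite ler_pdivrMr ?ltr0n// mul1r ler_nat max_card.
Qed.

Section union_bound.
Context d (T : measurableType d) (R : realType) (P : probability T R).

Lemma cvg_probability_bigsetU (I : finType) (B : I -> nat -> set T)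
    (A : nat -> set T) :
  (forall i n, measurable (B i n)) -> (forall n, measurable (A n)) ->
  (forall i, P (B i n) @[n --> \oo] --> 0%E) ->
  (\forall n \near \oo, A n `<=` \bigcup_i B i n) ->
  P (A n) @[n --> \oo] --> 0%E.
Proof.
move=> mB mA B_cvg AB.
have sum_cvg : (\sum_i P (B i n))%E @[n --> \oo] --> 0%E.
  have := @cvg_nnesum _ \oo _ _ I (index_enum I) (fun i n => P (B i n))
    (fun=> 0%E) predT; rewrite big1//; apply => i _ //.
  by apply: nearW => n; exact: measure_ge0.
apply: (squeeze_cvge _ (cvg_cst 0%E) sum_cvg).
apply: filterS AB => n AB; rewrite measure_ge0/=.
have mU (r : seq I) : measurable (\big[setU/set0]_(i <- r) B i n).
  by elim: r => [|i r IH]; rewrite ?big_nil// big_cons; exact: measurableU.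
apply: (@le_trans _ _ (P (\big[setU/set0]_i B i n))).
  apply: le_measure; rewrite ?inE//.
  apply: subset_trans AB _ => w [i _ wB]; rewrite -bigcup_seq; exists i => //.
  by rewrite /= mem_index_enum.
elim: (index_enum I) (mU) => [|i r IH] _; first by rewrite !big_nil measure0.
by rewrite !big_cons (le_trans (measureU2 _ _ _))// leeD2l// IH.
Qed.

End union_bound.

Theorem theorem5p4 (R : realType) (nu : probability R R)
    (nu01 : nu `[0, 1]%classic = 1%E)
    (d : measure_display) (T : measurableType d) (P : probability T R)
    (theta : nat -> {RV P >-> R}) (Ginf : T -> sgraph nat) :
  iid nu theta ->
  infinite_random_graph theta Ginf ->
  cvg_in_probability P
    (fun n w => glim_of_graph R (induced_prefix n (Ginf w)))
    (Gamma_nu nu).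
Proof.
move=> theta_iid Ginf_random eps eps0.
have mE := measurable_edge Ginf_random.
pose dev (F : Defs.fgraph) n (G : sgraph 'I_n) : R :=
  `|hom_density R F G - kernel_density (mu_nu nu) (@Wker R) F|.
have dev_le1 F n (G : sgraph 'I_n) : dev F n G <= 1.
  have /andP[h0 h1] := hom_density01 R F G.
  have /andP[k0 k1] := kernel_density01 nu01 F.
  by rewrite /dev ler_norml; apply/andP; split; lra.
have half_ge0 m : 0 <= 2^-1 ^+ m :> R by rewrite exprn_ge0// invr_ge0.
have half_le1 m : 2^-1 ^+ m <= 1 :> R.
  by rewrite exprn_ile1// ?invr_ge0// invf_le1// ler1n.
(* graphs of order at least N cannot move the distance beyond eps *)
have [N _ Neps] : \forall m \near \oo, 2^-1 ^+ m < eps :> R.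
  have : (fun m => 2^-1 ^+ m : R) @ \oo --> 0.
    by apply: cvg_expr; rewrite ger0_norm ?invr_ge0// invf_lt1// ltr1n.
  by move=> /cvgr0Pnorm_lt/(_ _ eps0); apply: filterS => m; rewrite ger0_norm.
pose I : finType := {m : 'I_N & {ffun 'I_m * 'I_m -> bool}}.
(* i is an order below N with an adjacency table; its graph, if any, is unique *)
pose bad (i : I) n (G : sgraph 'I_n) : Prop :=
  exists2 F : sgraph 'I_(tag i), adj_table F = tagged i &
    eps < dev (existT _ (tag i : nat) F) n G.
apply: (@cvg_probability_bigsetU _ _ _ _ I
  (fun i n => [set w | bad i n (induced_prefix n (Ginf w))])) => [i n|n|i|].
- exact: measurable_prefix.
- exact: (measurable_prefix (fun G => eps < glim_dist (glim_of_graph R G) _)).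
- have [[F Fi]|nF] := pselect (exists F : sgraph 'I_(tag i), adj_table F = tagged i).
    rewrite (_ : (fun n => P _) = fun n => P [set w |
        eps < dev (existT _ (tag i : nat) F) n (induced_prefix n (Ginf w))]).
      exact: (cvg_hom_density_prob nu01 theta_iid Ginf_random).
    apply/funext => n; congr (P _); apply/seteqP; split => [w [F']|w wF].
      by rewrite -Fi => /adj_table_inj ->.
    by exists F.
  apply: cvg_near_cst; apply: nearW => n.
  rewrite (_ : [set w | _] = set0) ?measure0// -subset0 => w [F Fi _].
  by apply: nF; exists F.
have inv_near : \forall n \near \oo, n%:R^-1 < eps :> R.
  have /cvgr0Pnorm_lt/(_ _ eps0) := @cvg_invn R.
  by apply: filterS => n; rewrite ger0_norm.
apply: filterS inv_near => n n_eps w /=; apply: contraPP => no_bad.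
apply/negP; rewrite -leNgt /glim_dist ge_max /= subr0 card_ord; apply/andP; split.
  by rewrite ger0_norm// ltW.
apply: ge_sup => [|_ [F _ <-]]; first by eexists; exists (existT _ 0%N
  (induced_prefix 0 (SGraph (fun _ _ => erefl : false = false)
    (fun=> erefl : false = false)))).
have [F_small|F_large] := ltnP (tag F) N; last first.
  exact: le_trans (ler_piMr (half_ge0 _) (dev_le1 _ _ _)) (ltW (Neps _ F_large)).
apply: le_trans (ler_piMl (normr_ge0 _) (half_le1 _)) _.
rewrite leNgt; apply/negP => F_bad; apply: no_bad.
case: F F_small F_bad => m F /= m_lt F_bad.
by exists (existT _ (Ordinal m_lt) (adj_table F)) => //; exists F.
Qed.
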